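(* Let $n$ be a positive integer and let $H(x)=x^{3^n-3}$ be a power function over $\mathbb{F}_{3^n}$. If $n\equiv 0\pmod 4$, then $H$ is differentially $(-1,6)$-uniform with $(-1)$-differential spectrum $$\mathbb S=\left\{{}_{-1}\omega_0=\frac{5\cdot 3^n-5}{8},\ {}_{-1}\omega_1=1,\ {}_{-1}\omega_2=\frac{3^n+3}{4},\ {}_{-1}\omega_4=\frac{3^n-17}{8},\ {}_{-1}\omega_6=1\right\}.$$ If $n\equiv 2\pmod 4$, then $H$ is differentially $(-1,4)$-uniform with $(-1)$-differential spectrum $$\mathbb S=\left\{{}_{-1}\omega_0=\frac{5\cdot 3^n-13}{8},\ {}_{-1}\omega_1=1,\ {}_{-1}\omega_2=\frac{3^n+7}{4},\ {}_{-1}\omega_4=\frac{3^n-9}{8}\right\}.$$ If $n\equiv 1,3\pmod 4$, then $H$ is differentially $(-1,4)$-uniform with $(-1)$-differential spectrum $$\mathbb S=\left\{{}_{-1}\omega_0=\frac{5\cdot 3^n-7}{8},\ {}_{-1}\omega_1=1,\ {}_{-1}\omega_2=\frac{3^n+1}{4},\ {}_{-1}\omega_4=\frac{3^n-3}{8}\right\}.$$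
   Context: For a function $H:\mathbb{F}_q\to\mathbb{F}_q$ and $a,b,c\in\mathbb{F}_q$, define ${}_c\delta_H(a,b)=\#\{x\in\mathbb{F}_q : H(x+a)-cH(x)=b\}$. The $c$-differential uniformity is ${}_c\Delta_H=\max\{{}_c\delta_H(a,b) : a,b\in\mathbb{F}_q,\ \text{and } a\neq 0 \text{ if } c=1\}$; $H$ is differentially $(c,\delta)$-uniform if ${}_c\Delta_H=\delta$. For a power function $H(x)=x^d$ put ${}_c\omega_i=\#\{b\in\mathbb{F}_q : {}_c\delta_H(1,b)=i\}$ for $0\le i\le {}_c\Delta_H$; the $c$-differential spectrum of $H$ is the multiset $\mathbb S=\{{}_c\omega_i : 0\le i\le {}_c\Delta_H \text{ and } {}_c\omega_i>0\}$, written by listing the values of the ${}_c\omega_i$. Here $c=-1$.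
   Formalization: n=1 is excluded: there H is constant 1 on F_3, so the uniformity is 3, not 4. For n=2 only the four values ω_i are claimed, not (-1,4)-uniformity or the multiset S: there ω_4=0, so the uniformity is 2 and 0 is not in S. *)

(* Defs.v *)
From HB Require Import structures.
From mathcomp Require Import all_boot all_order all_algebra.
From mathcomp Require Export finmap multiset.

Set Implicit Arguments.
Unset Strict Implicit.
Unset Printing Implicit Defensive.

Import GRing.Theory.
Local Open Scope mset_scope.
Local Open Scope ring_scope.

Definition c_delta (F : finFieldType) (c : F) (H : F -> F) (a b : F) : nat :=
  #|[set x : F | H (x + a) - c * H x == b]|.

Definition c_uniformity (F : finFieldType) (c : F) (H : F -> F) : nat :=
  (\max_(a : F | (c == 1)%R ==> (a != 0)%R) \max_(b : F) c_delta c H a b)%N.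

Definition c_uniform (F : finFieldType) (c : F) (delta : nat) (H : F -> F) :=
  c_uniformity c H = delta.

Definition power_fun (F : finFieldType) (d : nat) : F -> F :=
  fun x => x ^+ d.
Arguments power_fun F d : clear implicits.

(* For power functions the shift a = 1 represents every a != 0; this is why omega and the
   spectrum take the exponent d rather than an arbitrary function. *)
Definition c_omega (F : finFieldType) (c : F) (d i : nat) : nat :=
  #|[set b : F | c_delta c (power_fun F d) 1 b == i]|.

Definition c_spectrum (F : finFieldType) (c : F) (d : nat) : {mset nat} :=
  seq_mset [seq c_omega c d i
           | i <- iota 0 (c_uniformity c (power_fun F d)).+1
           & (0 < c_omega c d i)%N].

(* Main.v *)
(* For x <> 0 the power function is x^-2.  Centering at the midpoint, x = y + 1 turns
   the equation H(x+1) + H(x) = b into (y-1)^-2 + (y+1)^-2 = b; when y <> 1, -1 this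
   reads v^2 - 1 = b with v = y^2 / (y^2 - 1), and y = 1, -1 are solutions exactly for
   b = 1.  A given v <> 0, 1 comes from two y if v(v-1) is a square and from none
   otherwise.  Hence the number of solutions is 1 for b = -1 (v = 0), is 2 or 6 for
   b = 1 (v^2 = -1, where -1 - v has order 8 and 3^n mod 16 decides), and is 0, 2 or 4
   for other b.  The value 4 requires v(v-1) and v(v+1) both to be squares, and
   the number of such v follows from a linear identity because v(v-1), v(v+1) and
   (v-1)(v+1) = (v-1)((v-1)-1) have a square product.  Counting the b and counting the
   x give the two remaining multiplicities. *)

Require Import Defs.
From mathcomp Require Import all_boot all_order all_algebra all_solvable all_field.
From mathcomp Require Import ring zify.

Set Implicit Arguments.
Unset Strict Implicit.
Unset Printing Implicit Defensive.

Import GRing.Theory Num.Theory.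
Local Open Scope ring_scope.

(** * Squares and the cyclic multiplicative group of a finite field *)

Lemma finField_expr_pred (F : finFieldType) (x : F) : x != 0 -> x ^+ #|F|.-1 = 1.
Proof.
move=> x_neq0; apply: (mulfI x_neq0).
by rewrite -exprS prednK ?expf_card ?mulr1 // ltnW // card_finNzRing_gt1.
Qed.

Lemma finField_prim_root (F : finFieldType) :
  exists g : F, (#|F|.-1).-primitive_root g.
Proof.
have q_gt1 := card_finNzRing_gt1 F.
have /hasP[g _ g_prim] : has (#|F|.-1).-primitive_root (enum (predC1 (0 : F))).
  apply: has_prim_root; first by case: #|F| q_gt1 => [|[]].
  - apply/allP=> x; rewrite mem_enum inE => x_neq0; rewrite unity_rootE.
    exact/eqP/finField_expr_pred.
  - exact: enum_uniq.
  - by rewrite -cardE cardC1.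
by exists g.
Qed.

Lemma finField_prim_rootX (F : finFieldType) (g x : F) :
  (#|F|.-1).-primitive_root g -> x != 0 -> exists k : nat, x = g ^+ k.
Proof.
move=> g_prim /finField_expr_pred x_expr.
by have [i ->] := prim_rootP g_prim x_expr; exists i.
Qed.

Definition is_sq (F : finFieldType) (x : F) := [exists s : F, s ^+ 2 == x].

Lemma is_sq1 (F : finFieldType) : is_sq (1 : F).
Proof. by apply/existsP; exists 1; rewrite expr1n. Qed.

Lemma opp_neq (F : fieldType) (x : F) : 2 != 0 :> F -> x != 0 -> x != - x.
Proof.
move=> two_neq0; apply: contra_neq => x_opp.
have /eqP : 2 * x = 0 by rewrite mulr_natl mulr2n {1}x_opp addNr.
by rewrite mulf_eq0 (negPf two_neq0) => /eqP.
Qed.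

Lemma card_sqrt (F : finFieldType) (x : F) :
  2 != 0 :> F -> x != 0 -> #|[set s : F | s ^+ 2 == x]| = (is_sq x).*2.
Proof.
move=> two_neq0 x_neq0; case: (boolP (is_sq x)) => [/existsP[s /eqP s2]|x_nsq].
  have s_neq0 : s != 0 by apply: contra_neq x_neq0 => s0; rewrite -s2 s0 expr0n.
  have s_neq_opp := opp_neq two_neq0 s_neq0.
  suff -> : [set t : F | t ^+ 2 == x] = [set s; - s] by rewrite cards2 s_neq_opp.
  by apply/setP => t; rewrite !inE -s2 eqf_sqr.
apply/eqP; rewrite cards_eq0; apply/eqP/setP => t; rewrite !inE.
by apply/negP => t2; case/existsP: x_nsq; exists t.
Qed.

Section Squares.
Variable F : finFieldType.
Hypothesis q_odd : odd #|F|.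
Implicit Types x y g : F.

(** The parity of an exponent of [g] is well defined because [#|F|.-1] is even. *)
Lemma is_sq_prim_root g (k : nat) :
  (#|F|.-1).-primitive_root g -> is_sq (g ^+ k) = ~~ odd k.
Proof.
move=> g_prim; have q_gt1 := card_finNzRing_gt1 F.
have q1_even : ~~ odd #|F|.-1 by case: #|F| q_odd => //= m; rewrite negbK.
apply/existsP/idP => [[s /eqP s2]|k_even]; last first.
  by exists (g ^+ k./2); rewrite -exprM muln2 halfK (negPf k_even) subn0.
have g_neq0 : g != 0.
  apply: contra_eq_neq (prim_expr_order g_prim) => ->.
  by rewrite expr0n -(prednK (prim_order_gt0 g_prim)) eq_sym oner_eq0.
have s_neq0 : s != 0.
  apply: contra_eq_neq s2 => ->; rewrite expr0n /= eq_sym.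
  exact: expf_neq0.
have [i def_s] := finField_prim_rootX g_prim s_neq0.
move/eqP: s2; rewrite def_s -exprM (eq_prim_root_expr g_prim) => /eqP eq_mod.
have := congr1 odd eq_mod.
by rewrite !odd_mod ?(negPf q1_even) // oddM andbF => <-.
Qed.

Lemma is_sqM x y : x != 0 -> y != 0 -> is_sq (x * y) = (is_sq x == is_sq y).
Proof.
have [g g_prim] := finField_prim_root F.
move=> /(finField_prim_rootX g_prim)[i ->] /(finField_prim_rootX g_prim)[j ->].
by rewrite -exprD !is_sq_prim_root // oddD; do 2!case: odd.
Qed.

(** Write x = g^k with g of order q - 1. Then 2m | q - 1 | km, so k is even. *)
Lemma is_sq_expr1 x (m : nat) : x ^+ m = 1 -> (m.*2 %| #|F|.-1)%N -> is_sq x.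
Proof.
have [g g_prim] := finField_prim_root F; have q1_gt0 := prim_order_gt0 g_prim.
move=> xm1 dvd_m.
have m_gt0 : (0 < m)%N by case: m dvd_m {xm1} => //; rewrite dvd0n; case: _.-1 q1_gt0.
have x_neq0 : x != 0.
  apply: contra_eq_neq xm1 => ->.
  by rewrite expr0n -(prednK m_gt0) eq_sym oner_eq0.
have [k def_x] := finField_prim_rootX g_prim x_neq0.
rewrite def_x is_sq_prim_root // -dvdn2.
move/eqP: xm1; rewrite def_x -exprM -(prim_order_dvd g_prim) => /(dvdn_trans dvd_m).
by rewrite -muln2 mulnC dvdn_pmul2r.
Qed.

(** If s^2 = x then s^(2m) = -1, and s^(q-1) = 1 makes (q-1)/(2m) even. Conversely x^(2m) = 1, so
    [is_sq_expr1] applies. *)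
Lemma is_sq_exprN1 x (m : nat) : -1 != 1 :> F -> x ^+ m = -1 ->
  (m.*2 %| #|F|.-1)%N -> is_sq x = (m.*2.*2 %| #|F|.-1)%N.
Proof.
move=> N1_neq1 xmN1 dvd_m; apply/idP/idP => [/existsP[s /eqP s2]|]; last first.
  by apply: is_sq_expr1; rewrite -muln2 exprM xmN1 sqrrN expr1n.
have s2m : s ^+ m.*2 = -1 by rewrite -mul2n exprM s2.
have q_gt1 := card_finNzRing_gt1 F.
have m_gt0 : (0 < m.*2)%N.
  by case: m.*2 dvd_m => //; rewrite dvd0n; case: #|F| q_gt1 => [|[]].
have s_neq0 : s != 0.
  apply: contra_eq_neq s2m => ->.
  by rewrite expr0n -(prednK m_gt0) eq_sym oppr_eq0 oner_eq0.
have := finField_expr_pred s_neq0.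
rewrite -(divnK dvd_m) mulnC exprM s2m -signr_odd => sgn.
rewrite -[m.*2.*2]muln2 dvdn_pmul2l // dvdn2; apply: contraPN sgn => ->.
by apply/eqP; rewrite expr1.
Qed.

End Squares.

(** Reduces an identity of characteristic 3 to one that [ring] or [field] can check, the multiple of
    3 being supplied as [z]. *)
Lemma eq_char3 (F : fieldType) (z x y : F) : 3 = 0 :> F -> x = y + 3 * z -> x = y.
Proof. by move=> -> ->; rewrite mul0r addr0. Qed.

(* The number of y whose parameter v = y^2 / (y^2 - 1) has the given value. *)
Definition fib (F : finFieldType) (v : F) : nat :=
  #|[set y : F | y ^+ 2 * (v - 1) == v]|.
Arguments fib F v%_R.

(** * Fibres of y -> y^2 / (y^2 - 1) in characteristic 3 *)

Section Char3.
Variable F : finFieldType.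
Hypothesis char3 : 3 = 0 :> F.
Hypothesis q_odd : odd #|F|.
Implicit Types v b y : F.

Lemma two_neq0 : 2 != 0 :> F.
Proof.
apply: contra_eq_neq char3 => two0.
by rewrite -[3%N]/(1 + 2)%N natrD two0 addr0 oner_eq0.
Qed.

Lemma add11_N1 : 1 + 1 = -1 :> F.
Proof. by apply: (eq_char3 (z := 1)) => //; ring. Qed.

Lemma opp1_neq1 : -1 != 1 :> F.
Proof. by rewrite eq_sym opp_neq ?two_neq0 ?oner_eq0. Qed.

Lemma eq_fib v y :
  (y ^+ 2 * (v - 1) == v) = (y ^+ 2 != 1) && (y ^+ 2 / (y ^+ 2 - 1) == v).
Proof.
case: (eqVneq (y ^+ 2) 1) => [->|y2_neq1] /=.
  by rewrite mul1r -[X in _ == X]addr0 (inj_eq (addrI _)) oppr_eq0 oner_eq0.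
have d_neq0 : y ^+ 2 - 1 != 0 by rewrite subr_eq0.
apply/eqP/eqP => [e|<-]; last by field.
apply: (mulIf d_neq0); rewrite divfK //.
by rewrite mulrBr mulr1 -[X in _ - X]e; ring.
Qed.

(** Multiplication by v - 1 sends the fibre bijectively onto the square roots of v(v - 1). *)
Lemma fib_sq v : v != 0 -> v != 1 -> fib v = (is_sq (v * (v - 1))).*2.
Proof.
move=> v_neq0 v_neq1; have d_neq0 : v - 1 != 0 by rewrite subr_eq0.
rewrite -card_sqrt ?two_neq0 ?mulf_neq0 // /fib.
rewrite -(card_imset _ (mulIf d_neq0)); apply: eq_card => s; rewrite !inE.
apply/imsetP/idP => [[y]|/eqP s2].
  by rewrite inE => /eqP e ->; rewrite exprMn [(v - 1) ^+ 2]expr2 mulrA e.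
exists (s / (v - 1)); last by rewrite divfK.
by rewrite inE; apply/eqP; rewrite exprMn s2; field.
Qed.

Lemma fib0 : fib (0 : F) = 1%N.
Proof.
rewrite /fib -(cards1 (0 : F)); apply: eq_card => y.
by rewrite !inE mulf_eq0 subr_eq0 (eq_sym 0) oner_eq0 orbF expf_eq0.
Qed.

Lemma fib1 : fib (1 : F) = 0%N.
Proof.
apply/eqP; rewrite /fib cards_eq0; apply/eqP/setP => y.
by rewrite !inE subrr mulr0 eq_sym oner_eq0.
Qed.

Lemma fibN1 : fib (-1 : F) = (is_sq (-1 : F)).*2.
Proof.
rewrite fib_sq ?oppr_eq0 ?oner_eq0 ?opp1_neq1 //; congr (is_sq _).*2.
by apply: (eq_char3 (z := 1)) => //; ring.
Qed.

(** Every y other than 1 and -1 lies in exactly one fibre. *)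
Lemma sum_fib : (\sum_(v : F) fib v + 2 = #|F|)%N.
Proof.
have -> : (\sum_(v : F) fib v = #|[set y : F | y ^+ 2 != 1%R]|)%N.
  rewrite -sum1dep_card [RHS](partition_big (fun y : F => y ^+ 2 / (y ^+ 2 - 1)) xpredT) //=.
  by apply: eq_bigr => v _; rewrite sum1dep_card; apply: eq_card => y; rewrite !inE eq_fib.
rewrite addnC -(cardsC [set y : F | y ^+ 2 == 1]) card_sqrt ?two_neq0 ?oner_eq0 //.
rewrite is_sq1; congr (_ + _)%N.
by apply: eq_card => y; rewrite !inE.
Qed.

(* The product of the three arguments v(v-1), v(v+1), (v-1)(v+1) is a square, so
   either all three are squares or exactly one is. *)
Lemma fib_triple v : v != 0 -> v != 1 -> v != -1 ->
  (fib v + fib (- v) + fib (v - 1) =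
     4 * ((fib v == 2%N) && (fib (- v) == 2%N)) + 2)%N.
Proof.
move=> v0 v1 vN1.
have vD1 : v + 1 != 0 by rewrite addr_eq0.
have vB1 : v - 1 != 0 by rewrite subr_eq0.
rewrite !fib_sq ?oppr_eq0 // ?eqr_oppLR //; last first.
  by rewrite subr_eq add11_N1.
have -> : - v * (- v - 1) = v * (v + 1) by ring.
have -> : (v - 1) * (v - 1 - 1) = (v - 1) * (v + 1).
  by apply: (eq_char3 (z := 1 - v)) => //; ring.
by rewrite !is_sqM //; do 3!case: is_sq.
Qed.

(* Summing fib_triple over v outside the prime field: each of the three sums is a
   translate or reflection of the total sum_fib. *)
Lemma card_fib_pairs :
  (4 * #|[set v : F | (fib v == 2%N) && (fib (- v) == 2%N)]|
     + 3 + 3 * fib (-1 : F) = #|F|)%N.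
Proof.
pose G v := (fib v == 2%N) && (fib (- v) == 2%N).
have -> : #|[set v | G v]| = (\sum_(v : F) G v)%N by rewrite -sum1dep_card big_mkcond.
have split3 (f : F -> nat) : (\sum_(v : F) f v =
    f 0%R + f 1%R + f (-1)%R + \sum_(v | [&& v != 0%R, v != 1%R & v != (-1)%R]) f v)%N.
  rewrite (bigD1 0) //= (bigD1 1) ?oner_eq0 //= (bigD1 (-1)) /=; last first.
    by rewrite oppr_eq0 oner_eq0 opp1_neq1.
  by rewrite !addnA; congr (_ + _)%N; apply: eq_bigl => v; rewrite andbA.
have sumN : (\sum_(v : F) fib (- v) = \sum_(v : F) fib v)%N.
  by rewrite [RHS](reindex_inj (@oppr_inj F)).
have sumB : (\sum_(v : F) fib (v - 1) = \sum_(v : F) fib v)%N.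
  by rewrite [RHS](reindex_inj (addIr (-1))).
have sum_G := split3 (fun v => G v : nat).
have sum_1 := split3 (fun=> 1%N).
have := split3 (fun v => fib v + fib (- v) + fib (v - 1))%N.
rewrite [X in _ = _ + X -> _](eq_bigr (fun v : F => 4 * G v + 2 * 1)%N); last first.
  by move=> v /and3P[? ? ?]; rewrite fib_triple.
do 3!rewrite big_split /=; rewrite sumN sumB -!big_distrr /=.
have B1 : (-1 - 1 = 1 :> F) by apply: (eq_char3 (z := -1)) => //; ring.
rewrite oppr0 !sub0r opprK subrr B1 !fib0 !fib1.
have card_F : (\sum_(v : F) 1 = #|F|)%N by rewrite sum1_card.
move: sum_G sum_1 sum_fib; rewrite card_F /G oppr0 opprK !fib0 !fib1 /= !andbF.
set a := (\sum_(v : F) (_ && _))%N; set b := (\sum_(v | _) (_ && _))%N.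
set c := (\sum_(v | _) 1)%N; set e := bigop _ _ _.
set f := fib _; set q := #|F|.
(* At 0, 1, -1 the triple sums add up to 3 + 3 [fib (-1)] and [G] fails. With N the number of v
   satisfying [G], this gives 3(q - 2) = 3 + 3 [fib (-1)] + 4N + 2(q - 3). *)
by lia.
Qed.

(** * Number of solutions for the shift 1 *)

Hypothesis q_gt3 : (3 < #|F|)%N.

Let H := power_fun F (#|F| - 3).
Let D b := c_delta (-1) H 1 b.

(** For y <> 0 this is y^q = y. At 0 both sides vanish, as q - 3 > 0 and the inverse of 0 is 0 by
    convention. *)
Lemma power_funE y : H y = (y ^+ 2)^-1.
Proof.
rewrite /H /power_fun; case: (eqVneq y 0) => [->|y_neq0].
  by rewrite !expr0n subn_eq0 leqNgt q_gt3 invr0.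
apply: (mulIf (expf_neq0 3 y_neq0)); rewrite -exprD subnK ?expf_card; last exact: ltnW.
by field.
Qed.

(** The extra 2 comes from y = 1 and y = -1: one term is then the conventional inverse of 0 and the
    other is 1, so their sum is 1. *)
Lemma delta_fib b : D b = (\sum_(v : F | v ^+ 2 == (b + 1)%R) fib v + 2 * (b == 1%R))%N.
Proof.
pose Y := [set y : F | ((y - 1) ^+ 2)^-1 + ((y + 1) ^+ 2)^-1 == b].
pose E := [set y : F | y ^+ 2 == 1].
have N1 : - (1 : F) - 1 = 1 by apply: (eq_char3 (z := -1)) => //; ring.
have -> : D b = #|Y|.
  rewrite -(card_imset Y (addIr 1)) /D /c_delta; apply: eq_card => x.
  rewrite inE !power_funE mulN1r opprK; apply/idP/imsetP => [x_b|[y]].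
    exists (x - 1); last by rewrite subrK.
    by rewrite inE subrK -addrA N1.
  by rewrite inE => + ->; rewrite -addrA add11_N1.
have YE y : y ^+ 2 = 1 -> ((y - 1) ^+ 2)^-1 + ((y + 1) ^+ 2)^-1 = 1.
  move/eqP; rewrite -{1}(expr1n F 2) eqf_sqr => /orP[]/eqP->.
    by rewrite subrr add11_N1 sqrrN expr0n expr1n invr0 invr1 add0r.
  by rewrite addNr N1 expr0n expr1n invr0 invr1 addr0.
have gE y : y ^+ 2 != 1 ->
    ((y - 1) ^+ 2)^-1 + ((y + 1) ^+ 2)^-1 = (y ^+ 2 / (y ^+ 2 - 1)) ^+ 2 - 1.
  move=> y2_neq1; have d_neq0 : y ^+ 2 - 1 != 0 by rewrite subr_eq0.
  have /norP[dm_neq0 dp_neq0] : ~~ ((y - 1 == 0) || (y + 1 == 0)).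
    by rewrite subr_eq0 addr_eq0 -eqf_sqr expr1n.
  (* Over the denominator (y^2 - 1)^2 the numerators are 2y^2 + 2 and 2y^2 - 1, which differ by
     3. *)
  apply/(eq_char3 (z := ((y ^+ 2 - 1) ^+ 2)^-1)) => //.
  by field; rewrite d_neq0 dm_neq0 dp_neq0.
rewrite -(cardsID E) addnC; congr (_ + _)%N; last first.
  case: (eqVneq b 1) => [b1|b_neq1].
    rewrite -[RHS]/(2 * 1)%N; have -> : Y :&: E = E.
      by apply/setIidPr/subsetP => y; rewrite !inE b1 => /eqP/YE->.
    by rewrite /E card_sqrt ?two_neq0 ?oner_eq0 // is_sq1.
  apply/eqP; rewrite cards_eq0; apply/eqP/setP => y; rewrite !inE.
  by apply: contra_neqF b_neq1 => /andP[/eqP <- /eqP/YE].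
rewrite -sum1_card (partition_big (fun y : F => y ^+ 2 / (y ^+ 2 - 1))
                                 (fun v => v ^+ 2 == b + 1)) /=; last first.
  by move=> y; rewrite !inE => /andP[y2_neq1 /eqP <-]; rewrite gE // subrK.
apply: eq_bigr => v /eqP v2; rewrite sum1dep_card; apply: eq_card => y.
rewrite !inE eq_fib andbAC; case: eqP => //= y2_neq1.
case: (eqVneq _ v) => //= def_v; rewrite gE; last exact/eqP.
by rewrite def_v v2 addrK eqxx.
Qed.

Lemma sqrB1_eq1 v : (v ^+ 2 - 1 == 1) = (v ^+ 2 == -1).
Proof. by rewrite subr_eq add11_N1. Qed.

Lemma delta_param v : v != 0 ->
  D (v ^+ 2 - 1) = (fib v + fib (- v) + 2 * (v ^+ 2 == - 1%R))%N.
Proof.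
move=> v_neq0; rewrite delta_fib subrK sqrB1_eq1; congr (_ + _)%N.
rewrite (bigD1 v) //= (bigD1 (- v)) /=; last first.
  by rewrite sqrrN eqxx eq_sym opp_neq ?two_neq0.
rewrite big1 ?addn0 // => w; rewrite eqf_sqr.
by case/andP => /andP[/orP[]-> //]; rewrite andbF.
Qed.

Lemma deltaN1 : D (-1) = 1%N.
Proof.
rewrite delta_fib addNr (negPf opp1_neq1) (bigD1 0) ?expr0n //= fib0 big1 // => w.
by rewrite expf_eq0 /= => /andP[->].
Qed.

Lemma delta_nsq b : ~~ is_sq (b + 1) -> D b = (2 * (b == 1%R))%N.
Proof.
move=> b_nsq; rewrite delta_fib big1 // => w w2.
by case/existsP: b_nsq; exists w.
Qed.

(** Splits on b + 1 being zero, a nonsquare or a nonzero square, and replaces [D b] by its value in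
    each case. *)
Variant delta_spec b : nat -> Prop :=
| DeltaN1 of b = -1 : delta_spec b 1
| DeltaNsq of ~~ is_sq (b + 1) : delta_spec b (2 * (b == 1%R))
| DeltaParam v of v != 0 & b = v ^+ 2 - 1 :
    delta_spec b (fib v + fib (- v) + 2 * (b == 1%R)).

Lemma deltaP b : delta_spec b (D b).
Proof.
case: (boolP (is_sq (b + 1))) => [/existsP[v /eqP v2]|b_nsq]; last first.
  by rewrite delta_nsq //; constructor.
have {v2} -> : b = v ^+ 2 - 1 by rewrite v2 addrK.
case: (eqVneq v 0) => [->|v_neq0].
  by rewrite expr0n sub0r deltaN1; constructor.
by rewrite delta_param // -sqrB1_eq1; apply: (@DeltaParam _ v).
Qed.

Lemma fib_double v : v != 0 -> exists c : bool, fib v = c.*2.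
Proof.
move=> v_neq0; case: (eqVneq v 1) => [->|v_neq1].
  by exists false; rewrite fib1.
by rewrite fib_sq //; exists (is_sq (v * (v - 1))).
Qed.

(** Here w = v(v - 1) satisfies w^2 = 2v = -v and w^4 = -1, so [is_sq_exprN1] with m = 4 decides
    whether w is a square. *)
Lemma fib_sqrtN1 v : v ^+ 2 = -1 -> (8 %| #|F|.-1)%N -> fib v = (16 %| #|F|.-1)%N.*2.
Proof.
move=> v2 dvd8.
have v_neq0 : v != 0 by apply: contra_eq_neq v2 => ->; rewrite expr0n /= eq_sym oppr_eq0 oner_eq0.
have v_neq1 : v != 1 by apply: contra_eq_neq v2 => ->; rewrite expr1n /= eq_sym opp1_neq1.
rewrite fib_sq //; congr (nat_of_bool _).*2.
set w := v * (v - 1).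
have w2 : w ^+ 2 = - v.
  have -> : w ^+ 2 = v ^+ 2 * (v ^+ 2 - 2 * v + 1) by rewrite /w; ring.
  by rewrite v2; apply: (eq_char3 (z := v)) => //; ring.
have w4 : w ^+ 4 = -1 by rewrite (exprM w 2 2) w2 sqrrN v2.
exact: (is_sq_exprN1 q_odd (m := 4) opp1_neq1 w4).
Qed.

(** * The multiplicities of the spectrum *)

Hypothesis sqN1_dvd8 : is_sq (-1 : F) -> (8 %| #|F|.-1)%N.

(** The condition for b = 1 to have six solutions; for q = 3^n it means 4 | n. *)
Let six := is_sq (-1 : F) && (16 %| #|F|.-1)%N.
Let omega i := c_omega (-1 : F) (#|F| - 3) i.

Lemma delta1 : D 1 = (2 + 4 * six)%N.
Proof.
rewrite /six; case: (boolP (is_sq (-1 : F))) => [sqN1|nsqN1]; last first.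
  by rewrite delta_nsq ?add11_N1 // eqxx.
have /existsP[v /eqP v2] := sqN1; have dvd8 := sqN1_dvd8 sqN1.
have v_neq0 : v != 0.
  by apply: contra_eq_neq v2 => ->; rewrite expr0n /= eq_sym oppr_eq0 oner_eq0.
have {1}-> : 1 = v ^+ 2 - 1 by apply/esym/eqP; rewrite sqrB1_eq1 v2.
by rewrite delta_param // !fib_sqrtN1 ?sqrrN // v2 eqxx; case: (16 %| _)%N.
Qed.

(** The fibres over v and -v have 0 or 2 elements each when v <> 0; only the fibre over v = 0, that
    is b = -1, is odd. *)
Lemma delta_neq1 b : b != 1 -> (D b \in [:: 0; 1; 2; 4]%N) && ((D b == 1%N) == (b == -1)).
Proof.
move=> b_neq1; case: (eqVneq b (-1)) => [->|b_neqN1]; first by rewrite deltaN1.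
case: deltaP => [bN1|_|v v_neq0 def_b]; first by rewrite bN1 eqxx in b_neqN1.
  by rewrite (negPf b_neq1).
have [[] ->] := fib_double v_neq0;
have [|[] ->] := @fib_double (- v); by rewrite ?oppr_eq0 ?(negPf b_neq1).
Qed.

Lemma omega1 : omega 1 = 1%N.
Proof.
rewrite -[RHS](cards1 (-1 : F)); apply: eq_card => b; rewrite !inE -/(D b).
case: (eqVneq b 1) => [->|/delta_neq1/andP[_ /eqP] //].
by rewrite delta1 [RHS]eq_sym (negPf opp1_neq1); case: six.
Qed.

Lemma omega6 : omega 6 = six.
Proof.
have -> : omega 6 = #|[set b : F | six && (b == 1)]|.
  apply: eq_card => b; rewrite !inE -/(D b).
  case: (eqVneq b 1) => [->|/delta_neq1/andP[+ _]]; first by rewrite delta1; case: six.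
  by rewrite andbF !inE => /or4P[] /eqP->.
case: six; first by rewrite -[RHS](cards1 (1 : F)); apply: eq_card => b; rewrite !inE.
by apply/eqP; rewrite cards_eq0; apply/eqP/setP => b; rewrite !inE.
Qed.

Lemma delta_in b : D b \in [:: 0; 1; 2; 4; 6]%N.
Proof.
case: (eqVneq b 1) => [->|/delta_neq1/andP[+ _]]; first by rewrite delta1; case: six.
by rewrite !inE => /or4P[] /eqP->.
Qed.

Lemma omega_eq0 i : i \notin [:: 0; 1; 2; 4; 6]%N -> omega i = 0%N.
Proof.
move=> i_notin; apply/eqP; rewrite cards_eq0; apply/eqP/setP => b; rewrite !inE -/(D b).
by apply: contraNF i_notin => /eqP <-; apply: delta_in.
Qed.

Lemma sum_omega : (omega 0 + omega 1 + omega 2 + omega 4 + omega 6 = #|F|)%N.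
Proof.
rewrite /omega /c_omega -!sum1dep_card !(big_mkcond (fun b : F => _ == _)) -!big_split.
rewrite -[RHS]sum1_card; apply: eq_bigr => b _ /=; rewrite -/(D b).
by have := delta_in b; rewrite !inE => /or4P[|||/orP[]] /eqP->.
Qed.

(** Each x is a solution for exactly one b. *)
Lemma sum_omega_delta : (omega 1 + 2 * omega 2 + 4 * omega 4 + 6 * omega 6 = #|F|)%N.
Proof.
have <- : (\sum_(b : F) D b = #|F|)%N.
  rewrite -[RHS]sum1_card [RHS](partition_big (fun x : F => H (x + 1) - (-1) * H x) xpredT) //=.
  by apply: eq_bigr => b _; rewrite sum1dep_card.
rewrite /omega /c_omega -!sum1dep_card !(big_mkcond (fun b : F => _ == _)) !big_distrr -!big_split.
apply: eq_bigr => b _ /=; rewrite -/(D b).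
by have := delta_in b; rewrite !inE => /or4P[|||/orP[]] /eqP->.
Qed.

(** A value b taken four times corresponds to a pair v, -v with v^2 = b + 1 <> -1. The two square
    roots of -1 satisfy the pair condition exactly when [six] holds, but they belong to b = 1, which
    is then taken six times; hence the correction. *)
Lemma omega4_fib :
  (2 * omega 4 + 2 * six = #|[set v : F | (fib v == 2%N) && (fib (- v) == 2%N)]|)%N.
Proof.
set G := [set v | _]; pose J := [set v : F | v ^+ 2 == -1].
have G_neq0 v : v \in G -> v != 0.
  by rewrite inE; apply: contraTneq => ->; rewrite fib0.
rewrite -(cardsID J) addnC; congr (_ + _)%N.
  have -> : G :&: J = if six then J else set0.
    apply/setP => v; rewrite (fun_if (fun A : {set F} => v \in A)) !inE /six.
    case: (eqVneq (v ^+ 2) (-1)) => [v2|_]; last by rewrite andbF if_same.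
    have sqN1 : is_sq (-1 : F) by apply/existsP; exists v; apply/eqP.
    by rewrite sqN1 !fib_sqrtN1 ?sqrrN ?sqN1_dvd8 //; case: (16 %| _)%N.
  rewrite /six; case: (boolP (is_sq (-1 : F))) => /= [sqN1|_]; last by rewrite cards0.
  case: (16 %| _)%N; last by rewrite cards0.
  by rewrite card_sqrt ?two_neq0 ?oppr_eq0 ?oner_eq0 // sqN1.
rewrite /omega /c_omega -sum1dep_card big_distrr /= -[RHS]sum1_card.
rewrite [RHS](partition_big (fun v : F => v ^+ 2 - 1) (fun b => D b == 4%N)) /=; last first.
  move=> v /setDP[vG]; rewrite inE => v2; rewrite delta_param ?G_neq0 // (negPf v2).
  by move: vG; rewrite inE => /andP[/eqP-> /eqP->].
apply: eq_bigr => b; rewrite -/(D b) muln1.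
move=> /eqP D4; rewrite sum1dep_card.
have b_neq1 : b != 1 by apply: contra_eq_neq D4 => ->; rewrite delta1; case: six.
case: deltaP D4 => [//||v v_neq0 def_b]; rewrite (negPf b_neq1) // addn0 => fib4.
have [/eqP fib_v /eqP fib_Nv] : fib v == 2%N /\ fib (- v) == 2%N.
  move: fib4; have [[] ->] := fib_double v_neq0;
  by have [|[] ->] := @fib_double (- v); rewrite ?oppr_eq0.
have v2_neqN1 : v ^+ 2 != -1 by rewrite -sqrB1_eq1 -def_b.
transitivity #|[set v; - v]|; first by rewrite cards2 opp_neq ?two_neq0.
apply: eq_card => w; rewrite !inE def_b (inj_eq (addIr _)) eqf_sqr.
case: eqVneq => [->|_] /=; first by rewrite v2_neqN1 fib_v fib_Nv.
by case: eqVneq => [->|_]; rewrite ?andbF // sqrrN opprK v2_neqN1 fib_v fib_Nv.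
Qed.

Lemma omega4 : (8 * omega 4 + 8 * six + 3 + 6 * is_sq (-1 : F)%R = #|F|)%N.
Proof. by rewrite -card_fib_pairs fibN1 -omega4_fib; lia. Qed.

(** * Arbitrary shifts and the uniformity *)

(** Substitute x = a t and use H(a t) = a^-2 H(t). *)
Lemma delta_scale a b : a != 0 -> c_delta (-1) H a b = D (b * a ^+ 2).
Proof.
move=> a_neq0; rewrite /D /c_delta -[RHS](card_imset _ (mulfI a_neq0)).
apply: eq_card => x; rewrite inE; apply/idP/imsetP => [|[t]].
  move=> x_b; exists (x / a); last by rewrite mulrC divfK.
  rewrite inE -(eqP x_b); apply/eqP.
  have -> : x / a + 1 = (x + a) / a by rewrite mulrDl divff.
  by rewrite !power_funE !exprMn !invfM !invrK; ring.
rewrite inE => t_b ->; apply/eqP/(mulIf (expf_neq0 2 a_neq0)); rewrite -(eqP t_b).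
have -> : a * t + a = a * (t + 1) by ring.
(* The inverses are generalized because t or t + 1 may be 0, while [field] would ask for both to be
   nonzero. *)
by rewrite !power_funE !exprMn !invfM; move: (t + 1)^-1 t^-1 => u w; field.
Qed.

(** As c = -1 differs from 1, the maximum includes a = 0. There 2 H(x) = b says that the inverse of
    x is a square root of -b. *)
Lemma delta_shift0 b : (c_delta (-1)%R H 0%R b <= 2)%N.
Proof.
have -> : c_delta (-1) H 0 b = #|[set s : F | s ^+ 2 == - b]|.
  rewrite -[RHS](card_imset _ (@invr_inj F)); apply: eq_card => x.
  rewrite inE addr0 mulN1r opprK power_funE -mulr2n -mulr_natl.
  have two_Nb : 2 = -1 :> F by rewrite -add11_N1.
  rewrite two_Nb mulN1r eqr_oppLR.
  apply/idP/imsetP => [x_b|[s]]; last by rewrite inE => + ->; rewrite exprVn invrK.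
  by exists x^-1; rewrite ?invrK // inE exprVn.
case: (eqVneq (- b) 0) => [->|b_neq0]; last first.
  by rewrite card_sqrt ?two_neq0 //; case: is_sq.
rewrite (_ : [set s : F | _] = [set 0]) ?cards1 //.
by apply/setP => s; rewrite !inE expf_eq0.
Qed.

Lemma uniformity_eq m : (2 <= m)%N -> (forall b, D b <= m)%N -> (0 < omega m)%N ->
  c_uniformity (-1) H = m.
Proof.
move=> m_ge2 D_le /card_gt0P[b]; rewrite inE => /eqP D_b.
apply/eqP; rewrite eqn_leq; apply/andP; split; last first.
  rewrite -{1}D_b; apply: (leq_trans (leq_bigmax (F := c_delta (-1) H 1) b)).
  by apply: (leq_bigmax_cond (F := fun a => \max_b c_delta (-1)%R H a b)%N); rewrite oner_eq0 implybT.
apply/bigmax_leqP => a _; apply/bigmax_leqP => b' _.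
case: (eqVneq a 0) => [->|a_neq0]; first exact: leq_trans (delta_shift0 b') m_ge2.
by rewrite delta_scale.
Qed.

Lemma uniformity6 : six -> c_uniformity (-1) H = 6%N.
Proof.
move=> is_six; apply: uniformity_eq => [//|b|]; last by rewrite omega6 is_six.
by have := delta_in b; rewrite !inE => /or4P[|||/orP[]] /eqP->.
Qed.

Lemma uniformity4 : ~~ six -> (0 < omega 4)%N -> c_uniformity (-1) H = 4%N.
Proof.
move=> not_six; apply: uniformity_eq => [//|b].
case: (eqVneq b 1) => [->|/delta_neq1/andP[+ _]]; first by rewrite delta1 (negPf not_six).
by rewrite !inE => /or4P[] /eqP->.
Qed.

End Char3.

(** * Residues of 3^n modulo 16 and the three cases *)

(** 3^4 = 81 is 1 modulo 16. *)
Lemma expn3_mod16 n : (3 ^ n %% 16 = 3 ^ (n %% 4) %% 16)%N.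
Proof.
by rewrite {1}(divn_eq n 4) mulnC expnD expnM -modnMml -modnXm exp1n mul1n.
Qed.

Lemma natr_eq_div (m x a b : nat) : (0 < m)%N -> (m * x + a = b)%N ->
  x%:R = (b%:R - a%:R) / m%:R :> rat.
Proof.
move=> m_gt0 <-; rewrite natrD natrM addrK mulrC mulKf //.
by rewrite pnatr_eq0 -lt0n.
Qed.

(** For n = 1 the exponent is 0 and H is constantly 1, so b = 2 has three solutions. For n = 2 the
    formula gives [omega 4] = 0 and the uniformity is 2; hence the guards [n <> 2]. *)
Theorem theorem10 (n : nat) (F : finFieldType)
    (hn : (1 < n)%N) (hF : #|F| = (3 ^ n)%N) :
  let d : nat := (3 ^ n - 3)%N in
  let omega (i : nat) : nat := c_omega (-1 : F) d i in
  let q : rat := 3 ^+ n in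
  [/\ (n = 0 %[mod 4])%N ->
        [/\ c_uniform (-1) 6 (power_fun F d),
            c_spectrum (-1 : F) d =
              seq_mset [:: omega 0%N; omega 1%N; omega 2%N; omega 4%N; omega 6%N]
          & [/\ (omega 0%N)%:R = (5 * q - 5) / 8,
                omega 1%N = 1%N,
                (omega 2%N)%:R = (q + 3) / 4,
                (omega 4%N)%:R = (q - 17) / 8
              & omega 6%N = 1%N]],
      (n = 2 %[mod 4])%N ->
        [/\ n <> 2%N -> c_uniform (-1) 4 (power_fun F d),
            n <> 2%N -> c_spectrum (-1 : F) d =
              seq_mset [:: omega 0%N; omega 1%N; omega 2%N; omega 4%N]
          & [/\ (omega 0%N)%:R = (5 * q - 13) / 8,
                omega 1%N = 1%N,
                (omega 2%N)%:R = (q + 7) / 4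
              & (omega 4%N)%:R = (q - 9) / 8]]
    & (n = 1 %[mod 4])%N \/ (n = 3 %[mod 4])%N ->
        [/\ c_uniform (-1) 4 (power_fun F d),
            c_spectrum (-1 : F) d =
              seq_mset [:: omega 0%N; omega 1%N; omega 2%N; omega 4%N]
          & [/\ (omega 0%N)%:R = (5 * q - 7) / 8,
                omega 1%N = 1%N,
                (omega 2%N)%:R = (q + 1) / 4
              & (omega 4%N)%:R = (q - 3) / 8]]].
Proof.
move=> d omega q.
have char3 : 3 = 0 :> F.
  by have := card_finPcharP hF isT; rewrite inE => /andP[_ /eqP].
have q_odd : odd #|F| by rewrite hF oddX orbT.
have q_gt3 : (3 < #|F|)%N by rewrite hF (ltn_exp2l 1 n).
have q_mod := expn3_mod16 n; rewrite -hF in q_mod.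
have sqN1 : is_sq (-1 : F) = (4 %| #|F|.-1)%N.
  apply: (is_sq_exprN1 q_odd (m := 1) (opp1_neq1 char3)); first exact: expr1.
  by rewrite dvdn2; case: #|F| q_odd => //= k; rewrite negbK.
(* Modulo 16, q is 1, 3, 9 or 11; divisibility of q - 1 by 4 leaves 1 and 9. *)
have dvd8 : is_sq (-1 : F) -> (8 %| #|F|.-1)%N.
  have := ltn_pmod n (isT : 0 < 4)%N.
  rewrite sqN1; case: (n %% 4)%N q_mod => [|[|[|[|//]]]] /= q_mod _; lia.
have := uniformity4 char3 q_odd q_gt3 dvd8.
have := uniformity6 char3 q_odd q_gt3 dvd8.
have := omega4 char3 q_odd q_gt3 dvd8.
have := sum_omega_delta char3 q_odd q_gt3 dvd8.
have := sum_omega char3 q_odd q_gt3 dvd8.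
have := omega_eq0 char3 q_odd q_gt3 dvd8.
have := omega6 char3 q_odd q_gt3 dvd8.
have := omega1 char3 q_odd q_gt3 dvd8.
rewrite sqN1 {}hF in q_mod q_gt3 * => w1 w6 w_eq0 sum_w sum_wD w4 unif6 unif4.
have w3 : omega 3 = 0%N by apply: w_eq0.
have w5 : omega 5 = 0%N by apply: w_eq0.
rewrite -?/(omega _) in w1 w6 sum_w sum_wD w4 unif4.
rewrite /q -natrX.
have pow_ge9 : (9 <= 3 ^ n)%N by rewrite (@leq_exp2l 3 2 n).
split=> [n0|n2|n13].
(* n >= 4 makes 3^n - 17, hence [omega 4], positive. *)
- have pow_ge81 : (81 <= 3 ^ n)%N by rewrite (@leq_exp2l 3 4 n) //; lia.
  have {}q_mod : (3 ^ n %% 16 = 1)%N by rewrite q_mod n0.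
  have six1 : (4 %| (3 ^ n).-1)%N && (16 %| (3 ^ n).-1)%N by apply/andP; split; lia.
  rewrite six1 in w6 w4 unif6; have {}unif6 := unif6 isT.
  have w0E : (8 * omega 0%N + 5 = 5 * 3 ^ n)%N by lia.
  (* The [+ 0] gives the equation the shape that [natr_eq_div] expects. *)
  have w2E : (4 * omega 2%N + 0 = 3 ^ n + 3)%N by lia.
  have w4E : (8 * omega 4%N + 17 = 3 ^ n)%N by lia.
  have w0_gt0 : (0 < omega 0)%N by lia.
  have w2_gt0 : (0 < omega 2)%N by lia.
  have w4_gt0 : (0 < omega 4)%N by lia.
  split=> //.
  + have supp : [seq i <- iota 0 7 | (0 < omega i)%N] = [:: 0; 1; 2; 4; 6]%N.
      by rewrite /= w0_gt0 w1 w2_gt0 w3 w4_gt0 w5 w6.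
    by rewrite /c_spectrum unif6 [filter _ _]supp.
  + split=> //.
    * by rewrite (natr_eq_div _ w0E) // natrM.
    * by rewrite (natr_eq_div _ w2E) // natrD mulr0n subr0.
    * by rewrite (natr_eq_div _ w4E).
- have {}q_mod : (3 ^ n %% 16 = 9)%N by rewrite q_mod n2.
  have four : (4 %| (3 ^ n).-1)%N by lia.
  have six0 : (16 %| (3 ^ n).-1)%N = false by lia.
  rewrite four six0 /= in w6 w4 unif4.
  have w0E : (8 * omega 0%N + 13 = 5 * 3 ^ n)%N by lia.
  have w2E : (4 * omega 2%N + 0 = 3 ^ n + 7)%N by lia.
  have w4E : (8 * omega 4%N + 9 = 3 ^ n)%N by lia.
  have w0_gt0 : (0 < omega 0)%N by lia.
  have w2_gt0 : (0 < omega 2)%N by lia.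
  have w4_gt0 : n <> 2%N -> (0 < omega 4)%N.
    have [//|n_gt2 _] : n = 2%N \/ (2 < n)%N by lia.
    have : (3 ^ 3 <= 3 ^ n)%N by rewrite leq_exp2l.
    by lia.
  split=> //.
  + by move=> /w4_gt0; apply: unif4.
  + move=> /w4_gt0 w4_neq0.
    have supp : [seq i <- iota 0 5 | (0 < omega i)%N] = [:: 0; 1; 2; 4]%N.
      by rewrite /= w0_gt0 w1 w2_gt0 w3 w4_neq0.
    by rewrite /c_spectrum unif4 // [filter _ _]supp.
  + split=> //.
    * by rewrite (natr_eq_div _ w0E) // natrM.
    * by rewrite (natr_eq_div _ w2E) // natrD mulr0n subr0.
    * by rewrite (natr_eq_div _ w4E).
- have {}q_mod : (3 ^ n %% 16 = 3 \/ 3 ^ n %% 16 = 11)%N.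
    by case: n13 => n_mod; rewrite q_mod n_mod; [left|right].
  have four : (4 %| (3 ^ n).-1)%N = false by lia.
  rewrite four /= in w6 w4 unif4.
  have w0E : (8 * omega 0%N + 7 = 5 * 3 ^ n)%N by lia.
  have w2E : (4 * omega 2%N + 0 = 3 ^ n + 1)%N by lia.
  have w4E : (8 * omega 4%N + 3 = 3 ^ n)%N by lia.
  have w0_gt0 : (0 < omega 0)%N by lia.
  have w2_gt0 : (0 < omega 2)%N by lia.
  have w4_gt0 : (0 < omega 4)%N by lia.
  have {}unif4 := unif4 isT w4_gt0.
  split=> //.
  + have supp : [seq i <- iota 0 5 | (0 < omega i)%N] = [:: 0; 1; 2; 4]%N.
      by rewrite /= w0_gt0 w1 w2_gt0 w3 w4_gt0.
    by rewrite /c_spectrum unif4 [filter _ _]supp.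
  + split=> //.
    * by rewrite (natr_eq_div _ w0E) // natrM.
    * by rewrite (natr_eq_div _ w2E) // natrD mulr0n subr0.
    * by rewrite (natr_eq_div _ w4E).
Qed.
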